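(* Let $X$ be a Baire topological vector space, let $Y$ be a Tychonoff space, and let $f:X\to Y$ be a linearly continuous function. Then the following conditions are equivalent: (1) $f$ is conically quasi-continuous; (2) $f$ is quasi-continuous; (3) $f$ is BP-measurable.
   Context: All topological vector spaces are over $\mathbb R$ and are assumed to be Hausdorff. A Baire topological vector space is a topological vector space that is a Baire space as a topological space. A function $f:X\to Y$ from a topological vector space $X$ to a topological space $Y$ is linearly continuous if for any $x,v\in X$ the function $\mathbb R\to Y$, $t\mapsto f(x+tv)$, is continuous. A function $f:X\to Y$ between topological spaces is quasi-continuous if for every point $x\in X$, every neighborhood $V\subset X$ of $x$ and every neighborhood $W\subset Y$ of $f(x)$ there exists a nonempty open set $U\subset V$ such that $f(U)\subset W$. A subset $U$ of a topological vector space $X$ is $x$-conical (conical at a point $x\in X$) if $U\neq\emptyset$ and for every $u\in U$ the open segment $(x;u)=\{(1-t)x+tu:0<t<1\}$ is contained in $U$. A function $f:X\to Y$ from a topological vector space $X$ to a topological space $Y$ is conically quasi-continuous if for any point $x\in X$, any $x$-conical open set $V\subset X$ and any open neighborhood $W\subset Y$ of $f(x)$ there exists an $x$-conical open set $U\subset V$ such that $f(U)\subset W$. A subset $U$ of a topological space $Y$ is functionally open if $U=g^{-1}(V)$ for some continuous $g:Y\to\mathbb R$ and some open $V\subseteq\mathbb R$. A subset $A$ of a topological space $X$ has the Baire property in $X$ if there is an open set $U\subset X$ such that $U\triangle A$ is meager in $X$. A function $f:X\to Y$ is BP-measurable if for every functionally open $U\subset Y$ the preimage $f^{-1}(U)$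 has the Baire property in $X$. *)

(* Defs.v *)
From HB Require Import structures.
From mathcomp Require Import all_boot all_order all_algebra.
From mathcomp Require Import all_classical all_reals all_analysis.

Set Implicit Arguments.
Unset Strict Implicit.
Unset Printing Implicit Defensive.

Import Order.TTheory GRing.Theory Num.Theory.
Import numFieldNormedType.Exports.

Local Open Scope classical_set_scope.
Local Open Scope ring_scope.

(* Topological vector spaces are rendered by [topologicalLmodType R] with
   [R : realType]: addition and scaling are continuous, and, unlike for
   [tvsType], no local convexity is assumed. Being Hausdorff is a separate
   hypothesis. *)

Definition tychonoff_space (Y : topologicalType) : Prop :=
  hausdorff_space Y /\ completely_regular_space Y.

(* The library states [completely_regular_space] with [uniform_separator];
   this is the textbook form, with continuous real-valued functions. *)
Lemma completely_regular_spaceP (R : realType) (Y : topologicalType) :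
  completely_regular_space Y <->
  forall (a : Y) (B : set Y), closed B -> ~ B a ->
    exists f : Y -> R, [/\ continuous f, range f `<=` `[0, 1],
      f a = 0 & forall b, B b -> f b = 1].
Proof.
split=> crY a B clB nBa.
  have /(@uniform_separatorP _ R)[f [cf f01 fa fB]] := crY a B clB nBa.
  exists f; split => //; first by apply: fa; exists a.
  by move=> b Bb; apply: fB; exists b.
have [f [cf f01 fa fB]] := crY a B clB nBa.
apply/(@uniform_separatorP _ R); exists f; split => //.
  by move=> _ [_ -> <-].
by move=> _ [b Bb <-]; exact: fB.
Qed.

Definition baire_space (X : topologicalType) : Prop :=
  forall F : (set X)^nat,
    (forall n, open (F n) /\ dense (F n)) -> dense (\bigcap_n F n).

Definition nowhere_dense (X : topologicalType) (A : set X) : Prop :=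
  interior (closure A) = set0.

Definition meager (X : topologicalType) (A : set X) : Prop :=
  exists2 F : (set X)^nat, (forall n, nowhere_dense (F n)) & A = \bigcup_n F n.

Definition baire_property (X : topologicalType) (A : set X) : Prop :=
  exists2 U : set X, open U & meager (U `+` A).

Definition functionally_open (R : realType) (Y : topologicalType)
    (U : set Y) : Prop :=
  exists (g : Y -> R) (V : set R), [/\ continuous g, open V & U = g @^-1` V].

Definition BP_measurable (R : realType) (X Y : topologicalType)
    (f : X -> Y) : Prop :=
  forall U : set Y, functionally_open R U -> baire_property (f @^-1` U).

Definition quasi_continuous (X Y : topologicalType) (f : X -> Y) : Prop :=
  forall (x : X) (V : set X) (W : set Y), nbhs x V -> nbhs (f x) W ->
    exists U : set X, [/\ open U, U !=set0, U `<=` V & f @` U `<=` W].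

Definition linearly_continuous (R : realType) (X : topologicalLmodType R)
    (Y : topologicalType) (f : X -> Y) : Prop :=
  forall x v : X, continuous (fun t : R => f (x + t *: v)).

Definition open_segment (R : realType) (X : lmodType R) (x u : X) : set X :=
  [set (1 - t) *: x + t *: u | t in `]0, 1[%classic].

Definition conical (R : realType) (X : lmodType R) (x : X)
    (U : set X) : Prop :=
  U !=set0 /\ forall u, U u -> open_segment x u `<=` U.

Definition conically_quasi_continuous (R : realType)
    (X : topologicalLmodType R) (Y : topologicalType) (f : X -> Y) : Prop :=
  forall (x : X) (V : set X) (W : set Y),
    conical x V -> open V -> open W -> W (f x) ->
    exists U : set X, [/\ conical x U, open U, U `<=` V & f @` U `<=` W].

(* Main.v *)
Require Import Defs.
From HB Require Import structures.
From mathcomp Require Import all_boot all_order all_algebra.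
From mathcomp Require Import all_classical all_reals all_analysis.

Set Implicit Arguments.
Unset Strict Implicit.
Unset Printing Implicit Defensive.

Import Order.TTheory GRing.Theory Num.Theory.
Import numFieldNormedType.Exports.

Local Open Scope classical_set_scope.
Local Open Scope ring_scope.

(** A conical open set at [x] contains points arbitrarily close to [x], so
    conical quasi-continuity implies quasi-continuity; and a quasi-continuous
    [f] satisfies [f @^-1` W `<=` closure (f @^-1` W)°] for every open [W], so
    that [f @^-1` W] differs from its interior by a nowhere dense set.

    The substance is the passage from BP-measurability to conical
    quasi-continuity, which rests on two category arguments along lines.

    The first ([meager_open_trace_eq0]) says that, for [f] linearly continuous
    and [O], [W] open, the set [A = O `&` f @^-1` W] is empty as soon as it is
    meager: if [y] were a point of [A], every point [v] of [X] would be carried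
    into [A] by one of the homotheties with centre [y] and ratio [1 / (n + 1)],
    and [X] would be a countable union of meager sets.

    The second ([conical_sublevel]) is for a linearly continuous [h : X -> R]
    with [h x < a] whose strict sublevel set [C = {h < a}] equals an open set
    [O] up to a meager set. By continuity on the segments from [x], the open
    cone [V] is the union over [n] of the sets of those [v] whose segment lies
    in [C] for ratios below [1 / (n + 1)]. After removal of the meager set of
    the [v] that some nonzero rational ratio carries into [O `+` C], these sets
    lie in the sets [E n] of those [v] in [V] that every rational ratio in
    [`]0, 1 / (n + 1)[] carries into [O]. As [V] is not meager, some [E n] is
    dense in a nonempty open [G `<=` V]. Homotheties with such rational ratios
    then map [G] into the closure of [O], on which [h] exceeds [a] only on a
    meager set, hence, by the first argument, nowhere on the open image of [G].
    By continuity on lines, [h <= a] holds on the images of [G] for all real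
    ratios in [`]0, 1 / (n + 1)[]; their union is the desired cone.

    Complete regularity of [Y] reduces an arbitrary target to this real-valued
    case. *)

(** * Meager sets *)

Section meager_sets.
Variable X : topologicalType.
Implicit Types A B O V : set X.

Lemma nowhere_denseS A B : A `<=` B -> nowhere_dense B -> nowhere_dense A.
Proof.
move=> AB ndB; rewrite /nowhere_dense -subset0 -ndB.
exact/interiorS/closureS.
Qed.

Lemma nowhere_dense0 : nowhere_dense (@set0 X).
Proof. by rewrite /nowhere_dense closure0 interior0. Qed.

Lemma nowhere_dense_meager A : nowhere_dense A -> meager A.
Proof. by move=> ndA; exists (fun=> A) => //; rewrite bigcup_const. Qed.

Lemma meagerS A B : A `<=` B -> meager B -> meager A.
Proof.
move=> AB [F ndF BE]; exists (fun n => F n `&` A).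
  by move=> n; apply: nowhere_denseS (ndF n); exact: subIsetl.
by rewrite -setI_bigcupl -BE setIidr.
Qed.

Lemma meager_bigcup (I : countType) (F : I -> set X) :
  (forall i, meager (F i)) -> meager (\bigcup_i F i).
Proof.
move=> mF.
have /choice[G GP] : forall i, exists G : (set X)^nat,
    (forall n, nowhere_dense (G n)) /\ F i = \bigcup_n G n.
  by move=> i; have [G] := mF i; exists G.
exists (fun k => if unpickle k is Some (i, n) then G i n else set0).
  move=> k; case: unpickle => [[i n]|]; last exact: nowhere_dense0.
  exact: (GP i).1.
apply/seteqP; split=> y.
  move=> [i _]; rewrite (GP i).2 => -[n _ Gy].
  by exists (pickle (i, n)) => //; rewrite pickleK.
move=> [k _]; case: unpickle => [[i n] Gy|//].
by exists i => //; rewrite (GP i).2; exists n.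
Qed.

Lemma meagerU A B : meager A -> meager B -> meager (A `|` B).
Proof.
move=> mA mB; have -> : A `|` B = \bigcup_b (if b then A else B).
  apply/seteqP; split=> [y [Ay|By]|y [[] _ Fy]];
    by [exists true|exists false|left|right].
by apply: meager_bigcup => -[].
Qed.

Lemma nowhere_dense_boundary O : open O -> nowhere_dense (closure O `\` O).
Proof.
move=> oO; have clD : closed (closure O `\` O).
  by rewrite setDE; apply: closedI;
    [exact: closed_closure|exact: open_closedC].
rewrite /nowhere_dense -subset0 -(proj1 (closure_id _) clD) => y Dy.
have [Oy _] := interior_subset Dy.
by have [z [Oz [_ nOz]]] := Oy _ Dy.
Qed.

Lemma baire_open_not_meager V :
  baire_space X -> open V -> V !=set0 -> ~ meager V.
Proof.
move=> bX oV V0 [F ndF VE].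
have oF n : open (~` closure (F n)) by exact/closed_openC/closed_closure.
have dF n : dense (~` closure (F n)).
  move=> O [y Oy] oO; apply: contrapT => /set0P/negP; rewrite negbK => /eqP.
  rewrite -setDE setD_eq0 (open_subsetE _ oO) => /(_ y Oy).
  by rewrite [_°](ndF n).
have [y [Vy yF]] := bX _ (fun n => conj (oF n) (dF n)) V V0 oV.
move: Vy; rewrite VE => -[n _ Fy].
by apply: (yF n I); exact: subset_closure.
Qed.

End meager_sets.

(** Openness of [phi] is what carries an open part of the closure of a
    preimage to an open part of the closure of the given set. *)
Lemma meager_preimage (X Z : topologicalType) (phi : X -> Z) (A : set Z) :
  continuous phi -> (forall B, open B -> open (phi @` B)) ->
  meager A -> meager (phi @^-1` A).
Proof.
move=> cphi ophi [F ndF ->]; exists (fun n => phi @^-1` F n); last first.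
  by rewrite preimage_bigcup.
move=> n; rewrite /nowhere_dense -subset0 => y.
set B := (closure _)° => By.
have BF : phi @` B `<=` closure (F n).
  move=> _ [z /interior_subset Bz <-] N /cphi /Bz[w [Fw Nw]].
  by exists (phi w).
move: BF; rewrite open_subsetE; last exact/ophi/open_interior.
by rewrite [(closure (F n))°]ndF => /(_ (phi y)); apply; exists y.
Qed.

(** * Homotheties *)

Section homothety.
Variables (R : realType) (X : topologicalLmodType R).
Implicit Types (x v : X) (s t : R).

Definition homothety x t v : X := x + t *: (v - x).

Lemma homothetyE x t v : homothety x t v = (1 - t) *: x + t *: v.
Proof.
by rewrite /homothety scalerBr scalerBl scale1r addrCA addrC -!addrA.
Qed.

Lemma homothetyM x s t v :
  homothety x s (homothety x t v) = homothety x (s * t) v.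
Proof. by rewrite /homothety [x + _ - x]addrAC subrr add0r scalerA. Qed.

Lemma homothetyK x t : t != 0 -> cancel (homothety x t) (homothety x t^-1).
Proof.
by move=> t0 v; rewrite homothetyM mulVf// /homothety scale1r addrC subrK.
Qed.

Lemma continuous_addZ (Z : topologicalType) x (k : Z -> R) (w : Z -> X) :
  continuous k -> continuous w -> continuous (fun z => x + k z *: w z).
Proof.
move=> ck cw z; apply: (@continuous2_cvg _ _ _ _ _ _ (fun=> x) _ +%R).
- exact: (@tvs.add_continuous X (x, k z *: w z)).
- exact: cvg_cst.
apply: (@continuous2_cvg _ R^o X _ _ _ k w *:%R).
- exact: (@tvs.scale_continuous R X (k z, w z)).
- exact: ck.
- exact: cw.
Qed.

Lemma continuous_line x v : continuous (fun t : R => x + t *: v).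
Proof.
by apply: continuous_addZ => t; [exact: cvg_id|exact: cvg_cst].
Qed.

Lemma continuous_homothety x t : continuous (homothety x t).
Proof.
have -> : homothety x t = fun v => (x - t *: x) + t *: v.
  by apply/funext => v; rewrite /homothety scalerBr addrA addrAC.
by apply: continuous_addZ => v; [exact: cvg_cst|exact: cvg_id].
Qed.

Lemma open_homothety x t (B : set X) :
  t != 0 -> open B -> open (homothety x t @` B).
Proof.
move=> t0 oB; have -> : homothety x t @` B = homothety x t^-1 @^-1` B.
  apply/seteqP; split=> [_ [v Bv <-]|v Bv].
    by rewrite /preimage/= homothetyK.
  exists (homothety x t^-1 v) => //.
  by rewrite -[X in homothety x X]invrK homothetyK// invr_eq0.
by apply: open_comp => // v _; exact: continuous_homothety.
Qed.

Lemma meager_homothety x t (A : set X) :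
  t != 0 -> meager A -> meager (homothety x t @^-1` A).
Proof.
move=> t0; apply: meager_preimage; first exact: continuous_homothety.
by move=> B; exact: open_homothety.
Qed.

Lemma conical_homothety x (V : set X) t v :
  conical x V -> V v -> 0 < t < 1 -> V (homothety x t v).
Proof.
move=> [_ cV] Vv t01; apply: (cV v Vv); exists t; last by rewrite homothetyE.
by rewrite /= in_itv.
Qed.

End homothety.

(** * Linearly continuous functions on Baire spaces *)

Section linearly_continuous.
Variables (R : realType) (X : topologicalLmodType R).

(** [A = O `&` f @^-1` W] need not be open, but each line through a point [y]
    of [A] meets it in a neighborhood of [y]. So the homotheties with centre [y]
    and ratios tending to [0] carry every point into [A]: their preimages of
    [A], meager with [A], would cover the Baire space [X]. *)
Lemma meager_open_trace_eq0 (Y : topologicalType) (f : X -> Y)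
    (O : set X) (W : set Y) :
  baire_space X -> linearly_continuous f -> open O -> open W ->
  meager (O `&` f @^-1` W) -> O `&` f @^-1` W = set0.
Proof.
move=> baireX cf oO oW mA; rewrite -subset0 => y [Oy Wy].
set A := O `&` f @^-1` W in mA.
apply: (@baire_open_not_meager X setT) => //; first exact: openT.
  by exists y.
apply: (@meagerS _ _ (\bigcup_n (homothety y n.+1%:R^-1 @^-1` A))); last first.
  by apply: meager_bigcup => n; apply: meager_homothety; rewrite // invr_eq0.
move=> v _; suff : \forall n \near \oo, A (homothety y n.+1%:R^-1 v).
  by move=> /filter_ex[n An]; exists n.
apply: (@cvg_harmonic R (fun t => A (homothety y t v))).
apply: filterI.
  apply: (@continuous_line _ _ y (v - y) 0 O).
  by rewrite scale0r addr0; exact: open_nbhs_nbhs.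
apply: (cf y (v - y) 0 W).
by rewrite scale0r addr0; exact: open_nbhs_nbhs.
Qed.

(** Category arguments handle only countably many ratios at once; this recovers
    the remaining ones. *)
Lemma rat_dense_line_le (h : X -> R) (x v : X) (a e : R) :
  linearly_continuous h ->
  (forall q : rat, (0 : R) < ratr q < e -> h (homothety x (ratr q) v) <= a) ->
  forall t, 0 < t < e -> h (homothety x t v) <= a.
Proof.
move=> ch hq t te; rewrite leNgt; apply/negP => at_.
pose T := `]0, e[%classic `&`
  (fun s => h (homothety x s v)) @^-1` [set r | a < r].
have oT : open T.
  apply: openI; first exact: itv_open.
  by apply: open_comp (@open_gt R a) => s _; exact: ch.
have [||s [[se hs] [q _ qs]]] := @dense_rat R T.
- by exists t; split => //=; rewrite in_itv.
- exact: oT.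
by move: se hs; rewrite -qs /= in_itv/= => /hq; rewrite leNgt => /negP.
Qed.

(** The strict sublevel set need only be open up to a meager set; the price is
    the weak inequality in the conclusion, since points of the closure of its
    open model are excluded only from [{h > a}]. *)
Lemma conical_sublevel (h : X -> R) (a : R) (x : X) (V : set X) :
  baire_space X -> linearly_continuous h ->
  baire_property (h @^-1` [set r | r < a]) ->
  h x < a -> conical x V -> open V ->
  exists U, [/\ conical x U, open U, U `<=` V & forall u, U u -> h u <= a].
Proof.
move=> baireX ch [ O oO mOC] hxa cV oV; set C := h @^-1` _ in mOC.
pose e (n : nat) : R := n.+1%:R^-1.
have e_gt0 n : 0 < e n by rewrite invr_gt0 ltr0n.
have e_le1 n : e n <= 1 by rewrite invf_le1// ler1n.
pose E n := [set v | V v /\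
  forall q : rat, (0 : R) < ratr q < e n -> O (homothety x (ratr q) v)].
(* The first union covers the points of V outside the second, which is meager:
   it collects the points that some nonzero rational ratio carries to where O
   and C differ. Ratio 0 is excluded because its homothety is constant. *)
have VE : V `<=` \bigcup_n E n `|`
    \bigcup_(q : rat) (if q == 0 then set0
                       else homothety x (ratr q) @^-1` (O `+` C)).
  move=> v Vv; apply: contrapT => /not_orP[nE nq].
  have /nbhs_ballP[r /= r0 rC] : nbhs (0 : R) (fun t => C (homothety x t v)).
    apply: (ch x (v - x) 0 [set r | r < a]).
    by rewrite scale0r addr0; exact: open_nbhs_nbhs (conj (@open_lt R a) hxa).
  have [n nr] := filter_ex (near_infty_natSinv_lt (PosNum r0)).
  apply: nE; exists n => //; split=> // q /andP[q0 qe].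
  have Cq : C (homothety x (ratr q) v).
    apply: rC; rewrite /ball/= sub0r normrN gtr0_norm//.
    exact: lt_trans nr.
  apply: contrapT => nO; apply: nq; exists q => //.
  have q0' : q == 0 = false by move: q0; rewrite ltr0q => /gt_eqF.
  by rewrite q0' setY_def; right.
have [n nEn] : exists n, ~ nowhere_dense (E n).
  apply/existsNP => ndE.
  apply: (@baire_open_not_meager X V) => //; first exact: cV.1.
  apply: meagerS VE _; apply: meagerU.
    by exists E.
  apply: meager_bigcup => q; case: eqVneq => [_|q0].
    exact/nowhere_dense_meager/nowhere_dense0.
  by apply: meager_homothety => //; rewrite fmorph_eq0.
have [w wE] : (closure (E n))° !=set0 by apply/set0P/eqP.
pose G := (closure (E n))° `&` V.
have oG : open G by apply: openI => //; exact: open_interior.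
have [g Gg] : G !=set0.
  have [z [[Vz _] Ez]] := interior_subset wE _ (nbhs_interior wE).
  by exists z.
have hrat q : (0 : R) < ratr q < e n -> forall v, G v ->
    h (homothety x (ratr q) v) <= a.
  move=> qe v Gv; rewrite leNgt; apply/negP => hv.
  have q0 : ratr q != 0 :> R by case/andP: qe => /gt_eqF->.
  (* On H, the set {h > a} lies in the union of closure O `\` O and O `\` C. *)
  set H := homothety x (ratr q) @` G.
  have oH : open H by exact: open_homothety.
  have HO : H `<=` closure O.
    move=> _ [z [/interior_subset Ez _] <-] N /continuous_homothety /Ez.
    move=> [u [[_ uO] Nu]]; exists (homothety x (ratr q) u).
    by split=> //; exact: uO.
  have : (H `&` h @^-1` [set r | a < r]) (homothety x (ratr q) v).
    by split=> //; exists v.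
  rewrite (meager_open_trace_eq0 baireX ch oH (@open_gt R a))//.
  apply: (@meagerS _ _ ((closure O `\` O) `|` (O `+` C))); last first.
    apply: meagerU => //.
    exact/nowhere_dense_meager/nowhere_dense_boundary.
  move=> z [Hz az]; have [Oz|nOz] := pselect (O z); last first.
    by left; split=> //; exact: HO.
  right; rewrite setY_def; left; split=> // /(lt_trans az).
  by rewrite ltxx.
(* Letting the ratio range over the whole interval makes the union conical. *)
exists (\bigcup_(t in `]0, e n[%classic) homothety x t @` G); split.
- split.
    have e20 : 0 < e n / 2 < e n.
      by rewrite divr_gt0 ?e_gt0//= gtr_pMr ?e_gt0// invf_lt1// ltr1n.
    exists (homothety x (e n / 2) g), (e n / 2); last by exists g.
    by rewrite /= in_itv.
  move=> _ [t /= + [v Gv <-]] _ [s /= + <-].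
  rewrite !in_itv/= => /andP[t0 te] /andP[s0 s1].
  rewrite -homothetyE homothetyM; exists (s * t); last by exists v.
  rewrite /= in_itv/= mulr_gt0//=; apply: lt_trans te.
  by rewrite gtr_pMl.
- apply: bigcup_open => t /=; rewrite in_itv/= => /andP[t0 _].
  by apply: open_homothety => //; rewrite gt_eqF.
- move=> _ [t /= + [v [_ Vv] <-]]; rewrite in_itv/= => /andP[t0 te].
  by apply: conical_homothety => //; rewrite t0 (lt_le_trans te).
- move=> _ [t /= + [v Gv <-]]; rewrite in_itv/=.
  by apply: rat_dense_line_le => // q /hrat; exact.
Qed.

End linearly_continuous.

(** * The three implications *)

(** An open cone [U] at [x] on which [f] is close to [f x] need not lie near
    [x], but its intersection with any neighborhood of [x] is nonempty, since
    the segment from [x] to a point of [U] runs in [U]. *)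
Lemma conically_quasi_continuous_quasi_continuous (R : realType)
    (X : topologicalLmodType R) (Y : topologicalType) (f : X -> Y) :
  conically_quasi_continuous f -> quasi_continuous f.
Proof.
move=> qf x V W Vx Wfx.
have [||||U [cU oU _ fUW]] := qf x setT W°.
- by split=> //; exists x.
- exact: openT.
- exact: open_interior.
- exact: nbhs_singleton (nbhs_interior Wfx).
have [[u Uu] _] := cU.
exists (U `&` V°); split.
- by apply: openI => //; exact: open_interior.
- have /nbhs_ballP[r /= r0 rV] : nbhs (0 : R) (fun t => V° (homothety x t u)).
    apply: (@continuous_line _ _ x (u - x) 0 V°).
    by rewrite scale0r addr0; exact: nbhs_interior.
  have [n nr] := filter_ex (near_infty_natSinv_lt (PosNum r0)).
  (* n.+2 rather than n.+1, as the ratio must be less than 1. *)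
  exists (homothety x n.+2%:R^-1 u); split.
    apply: conical_homothety => //.
    by rewrite invr_gt0 ltr0n/= invf_lt1 ?ltr0n// ltr1n.
  apply: rV; rewrite /ball/= sub0r normrN gtr0_norm ?invr_gt0 ?ltr0n//.
  by apply: lt_trans nr; rewrite ltf_pV2 ?posrE ?ltr0n// ltr_nat.
- by move=> y [_ /interior_subset].
- by move=> _ [y [Uy _] <-]; apply: interior_subset; apply: fUW; exists y.
Qed.

Lemma quasi_continuous_subset_closure (X Y : topologicalType) (f : X -> Y)
    (W : set Y) :
  quasi_continuous f -> open W -> f @^-1` W `<=` closure (f @^-1` W)°.
Proof.
move=> qf oW x Wfx N Nx.
have [U [oU [u Uu] UN fUW]] := qf x N W Nx (open_nbhs_nbhs (conj oW Wfx)).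
exists u; split; last exact: UN.
have : U `<=` f @^-1` W by move=> z Uz; apply: fUW; exists z.
by rewrite open_subsetE// => /(_ u Uu).
Qed.

Lemma quasi_continuous_BP_measurable (R : realType) (X Y : topologicalType)
    (f : X -> Y) : quasi_continuous f -> BP_measurable R f.
Proof.
move=> qf W [g [B [cg oB ->]]].
have oW : open (g @^-1` B) by apply: open_comp => // y _; exact: cg.
exists (f @^-1` (g @^-1` B))°; first exact: open_interior.
apply: (@meagerS _ _ (closure (f @^-1` (g @^-1` B))° `\`
                      (f @^-1` (g @^-1` B))°)).
  rewrite setY_def => x [[/interior_subset fx /(_ fx)]//|[fx nfx]].
  by split=> //; exact: quasi_continuous_subset_closure.
exact/nowhere_dense_meager/nowhere_dense_boundary/open_interior.
Qed.

(** A function [g] separating [f x] from the complement of [W] makes the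
    sublevel sets of [g \o f] below [1] part of [f @^-1` W]; the level [1 / 2]
    leaves room for the weak inequality of [conical_sublevel]. *)
Lemma BP_measurable_conically_quasi_continuous (R : realType)
    (X : topologicalLmodType R) (Y : topologicalType) (f : X -> Y) :
  baire_space X -> completely_regular_space Y -> linearly_continuous f ->
  BP_measurable R f -> conically_quasi_continuous f.
Proof.
move=> bX /(completely_regular_spaceP R) crY cf mf x V W cV oV oW Wfx.
have [g [cg _ gx gW]] := crY (f x) (~` W) (open_closedC oW) (fun nW => nW Wfx).
have cgf : linearly_continuous (g \o f).
  move=> y v t; exact: (@cvg_comp _ _ _ (fun t => f (y + t *: v)) g _ _ _
                 (cf y v t) (cg (f (y + t *: v)))).
have bp : baire_property ((g \o f) @^-1` [set r | r < 2^-1]).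
  apply: (mf (g @^-1` [set r | r < 2^-1])).
  by exists g, [set r | r < 2^-1]; split=> //; exact: open_lt.
have gfx : (g \o f) x < 2^-1 by rewrite /= gx invr_gt0 ltr0n.
have [U [cU oU UV gU]] := conical_sublevel bX cgf bp gfx cV oV.
exists U; split=> // _ [u /gU + <-]; apply: contraPP => /gW /= ->.
by apply/negP; rewrite -ltNge invf_lt1 ?ltr0n// ltr1n.
Qed.

Theorem theorem1p3 (R : realType) (X : topologicalLmodType R)
    (Y : topologicalType) (f : X -> Y)
    (X_hausdorff : hausdorff_space X) (X_baire : baire_space X)
    (Y_tychonoff : tychonoff_space Y)
    (f_lin_cont : linearly_continuous f) :
  (conically_quasi_continuous f <-> quasi_continuous f) /\
  (quasi_continuous f <-> BP_measurable R f).
Proof.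
have c2q := @conically_quasi_continuous_quasi_continuous R X Y f.
have q2b := @quasi_continuous_BP_measurable R X Y f.
have b2c := BP_measurable_conically_quasi_continuous X_baire Y_tychonoff.2
  f_lin_cont.
by do 2![split] => // [/q2b/b2c|/b2c/c2q].
Qed.
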